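(* The following hold. (1) Let $\frac{r}{s},\frac{r'}{s}$ be irreducible fractions. If $rr'\equiv 1\pmod s$, then $\mathcal S^\flat_{\frac rs}(q)=\mathcal S^\flat_{\frac{r'}s}(q)$. If $rr'\equiv -1\pmod s$, then $\mathcal S^\flat_{\frac rs}(q)=\mathcal S^\flat_{\frac{r'}s}(q)^\vee$. (2) Let $\frac{r}{s},\frac{r}{s'}$ be irreducible fractions. If $ss'\equiv 1\pmod r$, then $\mathcal R^\flat_{\frac rs}(q)\equiv\mathcal R^\flat_{\frac{r}{s'}}(q)$. If $ss'\equiv -1\pmod r$, then $\mathcal R^\flat_{\frac rs}(q)\equiv\mathcal R^\flat_{\frac{r}{s'}}(q)^\vee$.
   Context: Irreducible fractions $\frac rs\in\mathbb{Q}$ are written with $s>0$. Each $\frac rs\in\mathbb Q$ has an even-length regular continued fraction $\frac rs=[a_1,\ldots,a_{2m}]=a_1+\cfrac{1}{a_2+\cfrac{1}{\ddots+\cfrac1{a_{2m}}}}$, unique under the conventions: if $\frac rs>0$, then $a_1\ge 0$ and $a_i\ge 1$ for $i\ge2$; if $\frac rs<0$, then $a_1\le 0$ and $a_i\le -1$ for $i\ge 2$; and $\frac01=[-1,1]$. Let $q$ be a formal parameter, $R_q=\begin{pmatrix} q&1\\0&1\end{pmatrix}$, $L_q=\begin{pmatrix}1&0\\1&q^{-1}\end{pmatrix}$, and $M_q(a_1,\ldots,a_{2m})=R_q^{a_1}L_q^{a_2}\cdots R_q^{a_{2m-1}}L_q^{a_{2m}}\in \mathrm{GL}(2,\mathbb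 Z[q^{\pm1}])$. Matrices act by fractional linear transformations. The left $q$-deformed rational number of $\frac rs=[a_1,\ldots,a_{2m}]$ is $\left[\frac rs\right]^\flat_q=M_q(a_1,\ldots,a_{2m})\left(\frac1{1-q}\right)$. It is written as $\left[\frac rs\right]^\flat_q=\frac{\mathcal R^\flat_{r/s}(q)}{\mathcal S^\flat_{r/s}(q)}$ with $\mathcal R^\flat_{r/s}(q)\in\mathbb Z[q^{\pm1}]$ and $\mathcal S^\flat_{r/s}(q)\in\mathbb Z[q]$ obtained by multiplying both entries of the vector $M_q(a_1,\ldots,a_{2m})\begin{pmatrix}1\\1-q\end{pmatrix}$ by a common $\pm q^n$ so that $\mathcal S^\flat_{r/s}(0)=1$. One has $\mathcal R^\flat_{r/s}(1)=r$ and $\mathcal S^\flat_{r/s}(1)=s$. For $f,g\in\mathbb Z[q^{\pm1}]$, $f\equiv g$ means $f=\pm q^n g$ for some $n\in\mathbb Z$ and some sign. The reciprocal is $f(q)^\vee:=q^{\deg f}f(q^{-1})$, where $\deg f$ is the largest exponent occurring in $f$. *)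

(* Defs.v *)
From HB Require Import structures.
From mathcomp Require Import all_boot all_order all_algebra.
From mathcomp Require Import ring lra zify.

Set Implicit Arguments.
Unset Strict Implicit.
Unset Printing Implicit Defensive.

Import Order.TTheory GRing.Theory Num.Theory.
Local Open Scope ring_scope.
Local Open Scope quotient_scope.

(* MathComp has no ring of Laurent polynomials: Z[q^{+-1}] is handled as the
   subring of Z(q) = {fraction {poly int}} of the elements satisfying
   [laurent]. *)
Notation Kq := {fraction {poly int}}.

Definition q : Kq := tofrac 'X.

Definition laurent (f : Kq) : Prop :=
  exists (n : int) (p : {poly int}), f = q ^ n * tofrac p.

Lemma q_neq0 : q != 0.
Proof. by rewrite /q tofrac_eq0 polyX_eq0. Qed.

Lemma q_expD (m n : int) : q ^ (m + n) = q ^ m * q ^ n.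
Proof. by rewrite expfzDr // q_neq0. Qed.

Lemma laurent_tofrac p : laurent (tofrac p).
Proof. by exists 0, p; rewrite expr0z mul1r. Qed.

Lemma laurent_qexp (n : int) : laurent (q ^ n).
Proof. by exists n, 1; rewrite tofrac1 mulr1. Qed.

Lemma laurentM f g : laurent f -> laurent g -> laurent (f * g).
Proof.
move=> [m [p ->]] [n [r ->]]; exists (m + n), (p * r).
by rewrite q_expD tofracM mulrACA.
Qed.

Lemma laurentD f g : laurent f -> laurent g -> laurent (f + g).
Proof.
move=> [m [p ->]] [n [r ->]].
wlog mn : m n p r / m <= n.
  by case: (leP m n) => [|/ltW] mn W; [|rewrite addrC]; apply: W.
exists m, (p + 'X ^+ `|n - m|%N * r).
rewrite tofracD tofracM tofracXn mulrDr mulrA; congr (_ + _ * _).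
by rewrite -[in LHS](subrKC m n) q_expD; congr (_ * _); rewrite -{1}(@ger0_norm _ (n - m)) ?subr_ge0.
Qed.

Lemma laurentN f : laurent f -> laurent (- f).
Proof. by case=> n [p ->]; exists n, (- p); rewrite tofracN mulrN. Qed.

(* The innermost term a is computed as a + 0^-1, which is a since 0^-1 = 0. *)
Definition cf_val (a : seq int) : rat :=
  foldr (fun (c : int) (y : rat) => c%:Q + y^-1) 0 a.

Definition is_even_cf (x : rat) (a : seq int) : bool :=
  [&& ~~ odd (size a), cf_val a == x &
    if 0 < x then (0 <= head 0 a) && all (fun c => 1 <= c) (behead a)
    else if x < 0 then (head 0 a <= 0) && all (fun c => c <= -1) (behead a)
    else a == [:: -1; 1]].

Lemma cf_val_opp a : cf_val (map -%R a) = - cf_val a.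
Proof. by elim: a => [|c a IH] /=; rewrite ?oppr0 // IH invrN rmorphN opprD. Qed.

(* Regular expansions of x > 1 with either parity of the length. *)
Lemma cf_gt1_ex (b : bool) (s r : nat) : (0 < s)%N -> (s < r)%N ->
  exists a : seq int, [/\ odd (size a) = b, cf_val a = r%:Q / s%:Q
                        & all (fun c => 1 <= c) a].
Proof.
elim/ltn_ind: s r b => s IH r b s0 sr.
have s0Q : (s%:Q != 0 :> rat) by rewrite intr_eq0; lia.
have E := divn_eq r s; have Lm := ltn_pmod r s0.
have k1 : (1 <= r %/ s)%N by rewrite divn_gt0 // ltnW.
move: E k1 Lm; set k := (r %/ s)%N; set m := (r %% s)%N => E k1 Lm.
have [m0|m0] := posnP m.
  have xk : r%:Q / s%:Q = k%:Q.
    by rewrite E m0 addn0 PoszM rmorphM /= mulfK.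
  have k2 : (2 <= k)%N by move: E sr; rewrite m0; nia.
  case: b.
    by exists [:: k%:Z]; split; rewrite ?xk //= ?invr0 ?addr0 ?andbT //; lia.
  exists [:: k%:Z - 1; 1]; split => //=; last by lia.
  by rewrite xk invr0 addr0 invr1 rmorphB /= subrK.
have [a [oa va alla]] := IH m Lm s (~~ b) m0 Lm.
have m0Q : (m%:Q != 0 :> rat) by rewrite intr_eq0; lia.
exists (k%:Z :: a); split => /=; first by rewrite oa negbK.
  by rewrite va invf_div E PoszD PoszM rmorphD rmorphM /= mulrDl mulfK.
by rewrite alla andbT; lia.
Qed.

Lemma even_cf_pos_ex (r s : nat) : (0 < s)%N -> (0 < r)%N ->
  exists a : seq int, [/\ ~~ odd (size a), cf_val a = r%:Q / s%:Q,
     0 <= head 0 a & all (fun c => 1 <= c) (behead a)].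
Proof.
move=> s0 r0; have s0Q : (s%:Q != 0 :> rat) by rewrite intr_eq0; lia.
have E := divn_eq r s; have Lm := ltn_pmod r s0.
move: E Lm; set k := (r %/ s)%N; set m := (r %% s)%N => E Lm.
have [m0|m0] := posnP m.
  exists [:: k%:Z - 1; 1]; split => //=; last first.
    by move: E r0; rewrite m0; case: (k) => //; lia.
  by rewrite E m0 addn0 PoszM rmorphM /= mulfK // invr0 addr0 invr1 rmorphB /= subrK.
have [a [oa va alla]] := cf_gt1_ex true m0 Lm.
exists (k%:Z :: a); split => //=; first by rewrite oa.
by rewrite va invf_div E PoszD PoszM rmorphD rmorphM /= mulrDl mulfK.
Qed.

Lemma even_cf_ex (x : rat) : exists a, is_even_cf x a.
Proof.
have pos (y : rat) : 0 < y -> exists a : seq int,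
    [/\ ~~ odd (size a), cf_val a = y,
        0 <= head 0 a & all (fun c => 1 <= c) (behead a)].
  move=> y0; have n0 : 0 < numq y by rewrite numq_gt0.
  have d0 := denq_gt0 y.
  have [|| a Ha] := @even_cf_pos_ex `|numq y|%N `|denq y|%N; try lia.
  by exists a; move: Ha; rewrite !gtz0_abs // divq_num_den.
rewrite /is_even_cf; case: (ltgtP x 0) => [x0|x0|->]; last by exists [:: -1; 1].
  have [|a [ea va ha ta]] := pos (- x); first by rewrite oppr_gt0.
  exists (map -%R a); rewrite size_map ea cf_val_opp va opprK eqxx /=.
  case: a {ea va} ha ta => //= c a ha; rewrite oppr_le0 ha all_map.
  by apply: sub_all => d /=; rewrite lerN2.
have [a [ea va ha ta]] := pos x x0.
by exists a; rewrite ea va eqxx ha ta.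
Qed.

Definition even_cf (x : rat) : seq int := xchoose (even_cf_ex x).

Definition mx22 (a b c d : Kq) : 'M[Kq]_2 :=
  \matrix_(i < 2, j < 2)
    (if i == 0 then (if j == 0 then a else b) else (if j == 0 then c else d)).

Definition Rq : 'M[Kq]_2 := mx22 q 1 0 1.
Definition Lq : 'M[Kq]_2 := mx22 1 0 1 q^-1.

Fixpoint Mq (a : seq int) : 'M[Kq]_2 :=
  if a is a1 :: a2 :: t then Rq ^ a1 *m Lq ^ a2 *m Mq t else 1%:M.

Definition cv2 (u w : Kq) : 'cV[Kq]_2 := \col_(i < 2) (if i == 0 then u else w).

Definition flat_vec (x : rat) : 'cV[Kq]_2 :=
  Mq (even_cf x) *m cv2 1 (1 - q).

Lemma col2E (v : 'cV[Kq]_2) : v = cv2 (v 0 0) (v 1 0).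
Proof.
apply/matrixP => i j; rewrite !mxE (ord1 j).
by case: (i =P 0) => [-> //|]; case: i => [[|[|]]] // h; [case; apply: val_inj|move=> _; congr (v _ _); apply: val_inj].
Qed.

Lemma mul_mx22 a b c d u w :
  mx22 a b c d *m cv2 u w = cv2 (a * u + b * w) (c * u + d * w).
Proof.
apply/matrixP => i j; rewrite !mxE !big_ord_recl big_ord0 !mxE addr0.
by case: (i == 0).
Qed.

Lemma Rq_act u w : Rq *m cv2 u w = cv2 (q * u + w) w.
Proof. by rewrite mul_mx22 !mul1r mul0r add0r. Qed.

Lemma Lq_act u w : Lq *m cv2 u w = cv2 u (u + q^-1 * w).
Proof. by rewrite mul_mx22 !mul1r mul0r addr0. Qed.

Lemma det_mx22 a b c d : \det (mx22 a b c d) = a * d - b * c.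
Proof.
rewrite (expand_det_row _ 0) !big_ord_recl big_ord0 /cofactor !det_mx11 !mxE /=.
by rewrite expr0 expr1 mul1r addr0 mulN1r mulrN.
Qed.

Lemma Rq_unit : Rq \in unitmx.
Proof. by rewrite unitmxE det_mx22 mulr0 subr0 mulr1 unitfE q_neq0. Qed.

Lemma Lq_unit : Lq \in unitmx.
Proof. by rewrite unitmxE det_mx22 mul0r subr0 mul1r unitfE invr_eq0 q_neq0. Qed.

Lemma RqV_act u w : Rq^-1 *m cv2 u w = cv2 (q^-1 * (u - w)) w.
Proof.
have -> : cv2 u w = Rq *m cv2 (q^-1 * (u - w)) w.
  by rewrite Rq_act mulVKf ?q_neq0 // subrK.
by rewrite mulKmx ?Rq_unit.
Qed.

Lemma LqV_act u w : Lq^-1 *m cv2 u w = cv2 u (q * (w - u)).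
Proof.
have -> : cv2 u w = Lq *m cv2 u (q * (w - u)).
  by rewrite Lq_act mulKf ?q_neq0 // addrC subrK.
by rewrite mulKmx ?Lq_unit.
Qed.

Lemma exp_inv (P : 'cV[Kq]_2 -> Prop) (M : 'M[Kq]_2) (n : nat) v :
  (forall v, P v -> P (M *m v)) -> P v -> P (M ^+ n *m v).
Proof.
move=> H Pv; elim: n => [|n IH]; first by rewrite expr0 mul1mx.
by rewrite exprS -mulmxA; apply: H.
Qed.

Lemma expz_ge0_inv (P : 'cV[Kq]_2 -> Prop) (M : 'M[Kq]_2) (n : int) v : 0 <= n ->
  (forall v, P v -> P (M *m v)) -> P v -> P (M ^ n *m v).
Proof. by case: n => n // _; apply: exp_inv. Qed.

Lemma expz_le0_inv (P : 'cV[Kq]_2 -> Prop) (M : 'M[Kq]_2) (n : int) v : n <= 0 ->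
  (forall v, P v -> P (M^-1 *m v)) -> P v -> P (M ^ n *m v).
Proof.
move=> n0; rewrite -[n]opprK -exprz_inv => H Pv.
by apply: expz_ge0_inv => //; rewrite oppr_ge0.
Qed.

Lemma expz_inv (P : 'cV[Kq]_2 -> Prop) (M : 'M[Kq]_2) (n : int) v :
  (forall v, P v -> P (M *m v)) -> (forall v, P v -> P (M^-1 *m v)) ->
  P v -> P (M ^ n *m v).
Proof.
by case: (leP 0 n) => [|/ltW] n0 H1 H2; [apply: expz_ge0_inv|apply: expz_le0_inv].
Qed.

Definition laurent_vec (v : 'cV[Kq]_2) := laurent (v 0 0) /\ laurent (v 1 0).

Lemma laurent_cv2 u w : laurent_vec (cv2 u w) <-> laurent u /\ laurent w.
Proof. by rewrite /laurent_vec !mxE. Qed.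

Lemma laurent_q : laurent q. Proof. exact: (laurent_qexp 1). Qed.
Lemma laurent_qV : laurent q^-1. Proof. exact: (laurent_qexp (-1)). Qed.

Lemma flat_vec_laurent x : laurent_vec (flat_vec x).
Proof.
rewrite /flat_vec; have: ~~ odd (size (even_cf x)).
  by case/and3P: (xchooseP (even_cf_ex x)).
move: (even_cf x) => a; have [k] := ubnP (size a).
have laurentE u w : laurent_vec (cv2 u w) -> laurent u /\ laurent w.
  by move/laurent_cv2.
elim: k a => // k IH [|a1 [|a2 t]] //= sz ev.
  rewrite mul1mx; apply/laurent_cv2; rewrite -tofrac1 -tofracB.
  by split; apply: laurent_tofrac.
have IHt : laurent_vec (Mq t *m cv2 1 (1 - q)).
  by apply: IH; [apply: leq_trans (ltnSE sz)|rewrite negbK in ev].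
rewrite -!mulmxA; apply: expz_inv; last apply: expz_inv => //.
- move=> v; rewrite (col2E v) Rq_act => /laurentE[hu hw]; apply/laurent_cv2.
  by split => //; apply: laurentD => //; apply: laurentM => //; apply: laurent_q.
- move=> v; rewrite (col2E v) RqV_act => /laurentE[hu hw]; apply/laurent_cv2.
  split => //; apply: laurentM; first exact: laurent_qV.
  by apply: laurentD => //; apply: laurentN.
- move=> v; rewrite (col2E v) Lq_act => /laurentE[hu hw]; apply/laurent_cv2.
  by split => //; apply: laurentD => //; apply: laurentM => //; apply: laurent_qV.
move=> v; rewrite (col2E v) LqV_act => /laurentE[hu hw]; apply/laurent_cv2.
split => //; apply: laurentM; first exact: laurent_q.
by apply: laurentD => //; apply: laurentN.
Qed.

(* Invariants showing that the lowest coefficient of the lower entry is +-1. *)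
Definition pos_inv (v : 'cV[Kq]_2) := exists (n : int) (p r : {poly int}),
  [/\ v 0 0 = q ^ n * tofrac p, v 1 0 = q ^ n * tofrac r & r.[0] = 1].
Definition neg_inv (v : 'cV[Kq]_2) := exists (n : int) (p r : {poly int}),
  [/\ v 0 0 = q ^ n * tofrac p, v 1 0 = q ^ n * tofrac ('X * r) & p.[0] = 1].
Definition low_pm1 (v : 'cV[Kq]_2) := exists (b : bool) (n : int) (r : {poly int}),
  v 1 0 = (-1) ^+ b * (q ^ n * tofrac r) /\ r.[0] = 1.

Lemma qVE n : q ^ n = q * q ^ (n - 1).
Proof. by have := q_expD 1 (n - 1); rewrite addrC subrK expr1z. Qed.

Lemma pos_inv_Rq v : pos_inv v -> pos_inv (Rq *m v).
Proof.
rewrite {2}(col2E v) Rq_act => -[n [p [r [hu hw r0]]]].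
exists n, ('X * p + r), r; split => //; rewrite !mxE //= hu hw.
by rewrite tofracD tofracM -/q; ring.
Qed.

Lemma pos_inv_Lq v : pos_inv v -> pos_inv (Lq *m v).
Proof.
rewrite {2}(col2E v) Lq_act => -[n [p [r [hu hw r0]]]].
exists (n - 1), ('X * p), ('X * p + r); split; last first.
- by rewrite !hornerE r0.
- rewrite !mxE /= hu hw (qVE n) tofracD tofracM -/q.
  by rewrite !mulrA mulVf ?q_neq0 // mul1r; ring.
by rewrite !mxE /= hu (qVE n) tofracM -/q; ring.
Qed.

Lemma low_pm1_pos v : pos_inv v -> low_pm1 v.
Proof. by case=> n [p [r [_ hw r0]]]; exists false, n, r; rewrite mul1r. Qed.

Lemma low_pm1_neg v : neg_inv v -> low_pm1 (Lq^-1 *m v).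
Proof.
rewrite (col2E v) LqV_act => -[n [p [r []]]]; rewrite !mxE /= => hu hw p0.
exists true, (n + 1), (p - 'X * r); rewrite !mxE /= hu hw expr1; split.
  by rewrite q_expD expr1z tofracB; ring.
by rewrite !hornerE p0 ?subr0.
Qed.

Lemma neg_inv_RqV v : neg_inv v -> neg_inv (Rq^-1 *m v).
Proof.
rewrite {2}(col2E v) RqV_act => -[n [p [r [hu hw p0]]]].
exists (n - 1), (p - 'X * r), ('X * r); split; last first.
- by rewrite !hornerE p0 ?subr0.
- by rewrite !mxE /= hw (qVE n) !tofracM -/q; ring.
rewrite !mxE /= hu hw (qVE n) tofracB !tofracM -/q -mulrBr.
by rewrite !mulrA mulVf ?q_neq0 // mul1r.
Qed.

Lemma neg_inv_LqV v : neg_inv v -> neg_inv (Lq^-1 *m v).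
Proof.
rewrite {2}(col2E v) LqV_act => -[n [p [r [hu hw p0]]]].
exists n, p, ('X * r - p); split => //; rewrite !mxE //= hu hw.
by rewrite !tofracM tofracB tofracM -/q; ring.
Qed.

Lemma low_pm1_R (n : int) v : low_pm1 v -> low_pm1 (Rq ^ n *m v).
Proof.
by apply: expz_inv => {}v; rewrite (col2E v) (Rq_act, RqV_act) /low_pm1 !mxE.
Qed.

Lemma pos_inv_Mq a : ~~ odd (size a) -> all (fun c => 0 <= c) a ->
  pos_inv (Mq a *m cv2 1 (1 - q)).
Proof.
have [k] := ubnP (size a).
elim: k a => // k IH [|a1 [|a2 t]] //= sz ev.
  move=> _; rewrite mul1mx; exists 0, 1, (1 - 'X); rewrite !mxE /= expr0z.
  by rewrite tofracB tofrac1 !mul1r !hornerE ?oppr0 ?addr0.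
case/and3P => a1p a2p tp; rewrite -!mulmxA.
apply: expz_ge0_inv => //; first exact: pos_inv_Rq.
apply: expz_ge0_inv => //; first exact: pos_inv_Lq.
by apply: IH => //; [apply: leq_trans (ltnSE sz)|rewrite negbK in ev].
Qed.

Lemma neg_inv_LqV_init : neg_inv (Lq^-1 *m cv2 1 (1 - q)).
Proof.
rewrite LqV_act; exists 0, 1, (- 'X); rewrite !mxE /= expr0z !mul1r tofrac1.
by split=> //; [rewrite tofracM tofracN -/q; ring|rewrite hornerE].
Qed.

Lemma low_pm1_init : low_pm1 (Lq^-1 *m cv2 1 (1 - q)).
Proof.
rewrite LqV_act; exists true, 2, 1; rewrite !mxE /= expr1 tofrac1; split.
  by rewrite -exprnP expr2; ring.
by rewrite hornerE.
Qed.

Definition neg_low v := neg_inv v /\ low_pm1 v.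

Lemma neg_low_LqV v : neg_inv v -> neg_low (Lq^-1 *m v).
Proof. by move=> h; split; [apply: neg_inv_LqV|apply: low_pm1_neg]. Qed.

Lemma neg_low_Mq a : ~~ odd (size a) -> (0 < size a)%N -> head 0 a <= 0 ->
  all (fun c => c <= -1) (behead a) -> neg_low (Mq a *m cv2 1 (1 - q)).
Proof.
have [k] := ubnP (size a).
elim: k a => // k IH [|a1 [|a2 t]] //= sz ev _ a1n /andP[a2n tn].
rewrite -!mulmxA.
suff [h1 h2] : neg_low (Lq ^ a2 *m (Mq t *m cv2 1 (1 - q))).
  split; last exact: low_pm1_R.
  by apply: expz_le0_inv => //; apply: neg_inv_RqV.
have -> : a2 = (a2 + 1) + (-1) by rewrite addrK.
rewrite exprzDr ?Lq_unit // -mulmxA exprN1.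
apply: expz_le0_inv; first lia; first by move=> v []; move/neg_low_LqV.
case: t sz ev tn => [|t1 t] sz ev tn.
  by rewrite /= mul1mx; split; [apply: neg_inv_LqV_init|apply: low_pm1_init].
have [] := IH (t1 :: t); rewrite ?negbK //=.
- by move: sz => /=; lia.
- by move: ev => /=; rewrite !negbK.
- by move: tn => /= /andP[]; lia.
- by move: tn => /= /andP[].
by move=> h _; apply: neg_low_LqV.
Qed.

Lemma flat_vec_low x : low_pm1 (flat_vec x).
Proof.
rewrite /flat_vec; case/and3P: (xchooseP (even_cf_ex x)).
rewrite -/(even_cf x); move: (even_cf x) => a ev /eqP va.
case: (ltgtP x 0) => x0.
- case/andP => h t; have a0 : (0 < size a)%N.
    by case: a va {ev h t} => //= va; rewrite -va ltxx in x0.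
  by have [] := neg_low_Mq ev a0 h t.
- case/andP => h t; apply: low_pm1_pos; apply: pos_inv_Mq => //.
  case: a h t {ev va} => //= c a -> /=.
  by apply: sub_all => d; apply: le_trans.
move/eqP->; rewrite /Mq -!mulmxA mul1mx; apply: low_pm1_R.
rewrite expr1z Lq_act; exists false, (-1), 1; rewrite !mxE /= hornerC mul1r tofrac1.
by rewrite mulr1 mulrBr mulr1 mulVf ?q_neq0 // addrC subrK.
Qed.

(* Multiplication by (-1)^b q^n turns the lower entry of flat_vec x into the
   polynomial s with s(0) = 1; d is the triple (b, n, s). *)
Definition is_flat_normalization (x : rat) (d : bool * int * {poly int}) : bool :=
  let: (b, n, s) := d in
  ((-1) ^+ b * q ^ n * flat_vec x 1 0 == tofrac s) && (s.[0] == 1).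

Lemma flat_normalization_ex x : exists d, is_flat_normalization x d.
Proof.
have [b [n [r [h r0]]]] := flat_vec_low x.
exists (b, - n, r); rewrite /is_flat_normalization h r0 eqxx andbT.
have -> : forall s y z t : Kq, s * y * (s * (z * t)) = (s * s) * (y * z) * t by move=> *; ring.
by rewrite -expr2 sqrr_sign mul1r -q_expD addNr expr0z mul1r.
Qed.

Definition flat_normalization (x : rat) : bool * int * {poly int} :=
  xchoose (flat_normalization_ex x).

(* Numerator (a Laurent polynomial) and denominator of the left q-rational. *)
Definition Rflat (x : rat) : Kq :=
  let: (b, n, _) := flat_normalization x in (-1) ^+ b * q ^ n * flat_vec x 0 0.

Definition Sflat (x : rat) : {poly int} := (flat_normalization x).2.

Lemma Rflat_laurent x : laurent (Rflat x).
Proof.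
rewrite /Rflat; case: (flat_normalization x) => [[b n] s].
apply: laurentM; last by case: (flat_vec_laurent x).
apply: laurentM (laurent_qexp n).
by rewrite -tofrac1 -tofracN -tofracXn; apply: laurent_tofrac.
Qed.

Definition qequiv (f g : Kq) : Prop :=
  exists (b : bool) (n : int), f = (-1) ^+ b * q ^ n * g.

(* f(q^-1), by substitution in the numerator and denominator of f. *)
Definition poly_at_qV (p : {poly int}) : Kq := (map_poly intr p).[q^-1].
Definition at_qV (f : Kq) : Kq :=
  poly_at_qV (frac (repr f)).1 / poly_at_qV (frac (repr f)).2.

(* deg(numerator) - deg(denominator): on nonzero Laurent polynomials this is
   the largest exponent, see [ldeg_laurent]. *)
Definition ldeg (f : Kq) : int :=
  (size (frac (repr f)).1)%:Z - (size (frac (repr f)).2)%:Z.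

Definition recip (f : Kq) : Kq := q ^ ldeg f * at_qV f.

Lemma frac_repr (f : Kq) :
  f * tofrac (frac (repr f)).2 = tofrac (frac (repr f)).1.
Proof.
have d0 := denom_ratioP (repr f).
rewrite -{1}[f]reprK; move: (repr f) d0 => y d0.
unlock tofrac; rewrite -[LHS]pi_mul; apply/eqmodP.
rewrite /= FracField.equivfE !numden_Ratio ?(mulr1, oner_neq0, mulf_neq0) //.
by rewrite mulrC.
Qed.

Lemma tofrac_coef (p : {poly int}) :
  tofrac p = \sum_(i < size p) (p`_i)%:~R * q ^+ i.
Proof.
rewrite -{1}(coefK p) poly_def rmorph_sum /=; apply: eq_bigr => i _.
rewrite -mul_polyC tofracM tofracXn -/q; congr (_ * _).
by rewrite -{1}(intz p`_i) !rmorph_int.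
Qed.

Lemma poly_at_qV_rev p :
  poly_at_qV p * q ^+ (size p).-1 = tofrac (Poly (rev p)).
Proof.
have -> : Poly (rev p) = \poly_(i < size p) p`_(size p - i.+1).
  apply/polyP => i; rewrite coef_Poly coef_poly.
  case: ltnP => ip; last by rewrite nth_default // size_rev.
  by rewrite nth_rev.
rewrite poly_def rmorph_sum /= (reindex_inj rev_ord_inj) /=.
rewrite /poly_at_qV (@horner_coef_wide _ (size p)); last exact: size_poly.
rewrite mulr_suml; apply: eq_bigr => i _.
have ip := ltn_ord i; rewrite subnSK // subKn ?(ltnW ip) //.
rewrite coef_map /= -mul_polyC tofracM tofracXn -/q -mulrA; congr (_ * _).
  by rewrite -{2}(intz p`_i) !rmorph_int.
rewrite exprVn.
have -> : (size p).-1 = (i + (size p - i.+1))%N by move: ip; clear; lia.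
by rewrite exprD mulKf // expf_neq0 // q_neq0.
Qed.

Lemma poly_at_qV_eq0 p : (poly_at_qV p == 0) = (p == 0).
Proof.
apply/idP/idP => [/eqP h|/eqP->]; last by rewrite /poly_at_qV rmorph0 horner0.
have := poly_at_qV_rev p; rewrite h mul0r => /esym/eqP.
rewrite tofrac_eq0 => /eqP h0; apply: contraT => p0.
have sp : (0 < size p)%N by rewrite size_poly_gt0.
have : (Poly (rev p))`_0 == 0 by rewrite h0 coef0.
by rewrite coef_Poly nth_rev // subn1 -lead_coefE lead_coef_eq0 (negPf p0).
Qed.

Lemma poly_at_qVM p r : poly_at_qV (p * r) = poly_at_qV p * poly_at_qV r.
Proof. by rewrite /poly_at_qV rmorphM hornerM. Qed.

Lemma poly_at_qVXn n : poly_at_qV 'X^n = q ^- n.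
Proof. by rewrite /poly_at_qV map_polyXn hornerXn exprVn. Qed.

Lemma laurent_cross (n : int) (p : {poly int}) (f := q ^ n * tofrac p) :
  exists a b : nat, n = a%:Z - b%:Z /\ (frac (repr f)).1 * 'X^b = 'X^a * p * (frac (repr f)).2.
Proof.
pose a := if 0 <= n then `|n|%N else 0%N.
pose b := if 0 <= n then 0%N else `|n|%N.
have nE : n = a%:Z - b%:Z by rewrite /a /b; case: ifP; lia.
exists a, b; split=> //; apply/eqP; rewrite -tofrac_eq !tofracM -frac_repr !tofracXn -/q.
rewrite {1}/f mulrAC; set d := tofrac _.2; apply/eqP.
suff -> : q ^+ a = q ^ n * q ^+ b by ring.
by rewrite !exprnP -q_expD {1}nE subrK.
Qed.

Lemma at_qV_laurent (n : int) p : at_qV (q ^ n * tofrac p) = q ^ (- n) * poly_at_qV p.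
Proof.
have [a [b [nE]]] := laurent_cross n p.
rewrite /at_qV; set f := q ^ n * _ => h.
have d0 : poly_at_qV (frac (repr f)).2 != 0.
  by rewrite poly_at_qV_eq0 denom_ratioP.
have b0 : q ^+ b != 0 by apply: expf_neq0; apply: q_neq0.
move/(congr1 poly_at_qV): h; rewrite !poly_at_qVM !poly_at_qVXn.
move/(canRL (mulfVK b0)) => ->.
have -> : q ^ (- n) = q ^+ b * q ^- a.
  by rewrite nE opprB q_expD (exprnN q a).
move: (q ^- a) (q ^+ b) (poly_at_qV p) (poly_at_qV _) d0 => x y z t t0.
by rewrite mulrAC mulfK // mulrC mulrA.
Qed.

Lemma ldeg_laurent (n : int) p : p != 0 ->
  ldeg (q ^ n * tofrac p) = n + (size p)%:Z - 1.
Proof.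
move=> p0; have [a [b [nE]]] := laurent_cross n p.
rewrite /ldeg; set f := q ^ n * _ => h.
have d0 : (frac (repr f)).2 != 0 by exact: denom_ratioP.
have n0 : (frac (repr f)).1 != 0.
  apply/eqP => z; move/eqP: h; rewrite z mul0r eq_sym !mulf_eq0.
  by rewrite (negPf p0) (negPf d0) expf_eq0 polyX_eq0 andbF.
have Xp0 : 'X^a * p != 0 by rewrite mulf_neq0 // expf_neq0 // polyX_eq0.
move/(congr1 (fun u : {poly int} => size u)): h.
rewrite size_mulXn // size_mul // mulrC size_mulXn //.
have arith (x y z : nat) : (0 < x)%N -> (0 < y)%N -> (0 < z)%N ->
    (b + z = (a + x + y).-1)%N -> z%:Z - y%:Z = a%:Z - b%:Z + x%:Z - 1 by lia.
by rewrite nE; apply: arith; rewrite size_poly_gt0.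
Qed.

Lemma recip_laurent (n : int) p : p != 0 ->
  recip (q ^ n * tofrac p) = tofrac (Poly (rev p)).
Proof.
move=> p0; rewrite /recip ldeg_laurent // at_qV_laurent mulrA -q_expD.
have -> : n + (size p)%:Z - 1 - n = (size p).-1%:Z.
  by move: p0; rewrite -size_poly_gt0; move: (size p) => x; lia.
by rewrite mulrC; apply: poly_at_qV_rev.
Qed.

(* Main.v *)
Require Import Defs.
From mathcomp Require Import all_boot all_order all_algebra.
From mathcomp Require Import ring lra zify.
Import Order.TTheory GRing.Theory Num.Theory.
Local Open Scope ring_scope.

(** Every positive rational is obtained from 1 by a unique word in the two maps
    x |-> x + 1 and x |-> x / (x + 1).  The matrices Rq and Lq deform these
    maps, and the vector of a positive rational x is the word of x, spelled
    with Rq and Lq, applied to Lq (1, 1 - q) = (1, q^-1).  For -x one has to use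
    the inverse matrices, and conjugation by diag(-q, 1) turns these into the
    same matrices with q replaced by q^-1 ([flat_vec_word]).  All statements
    thus become statements about [word_vec t W], the action of a word W with
    parameter t, where t is q, q^-1, or 1 for ordinary numerators and
    denominators.

    Four symmetries carry the proof.

    - Translation: the lower entry is invariant under Rq, so the denominator
      of x depends only on x modulo 1 ([Sflat_add1]).
    - Reversal: both generators are self-adjoint for the symmetric form
      [sform], and pairing with (1, 1 - t) is, up to the scalar
      1 - t - t^-1, the lower coordinate.  Hence a word that begins and ends
      with Lq keeps its lower entry when it is read backwards
      ([word_vec_rev]).  For t = 1 the matrix (r u; s v) of the word becomes
      (v u; s r), and rv - us = 1, so that r/s is replaced by v/s with
      rv = 1 modulo s.  With translation this gives the first claim on
      denominators ([Sflat_inverse]).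
    - Inversion of q: passing from x to -x replaces q by q^-1, which reverses
      the coefficients of the denominator.  The normalization at q = 0 leaves
      a sign, which is settled by the positivity of the value at q = 1
      ([Sflat_opp]).
    - Exchange: swapping the coordinates conjugates the generators of
      parameter t^-1 into those of parameter t with the two letters exchanged
      ([word_vec_flip]).  As exchanging the letters inverts a positive
      rational, the numerator of x is equivalent to the denominator of -1/x
      ([Rflat_Sflat]), and the claims on numerators follow from those on
      denominators. *)

(** * Words in the two generators *)

Section WordAction.
Context {F : comUnitRingType}.
Implicit Types (t : F) (x y : F * F) (W : seq bool).

(** The letter [true] stands for R and [false] for L, both with parameter t. *)
Definition step t (b : bool) x : F * F :=
  if b then (t * x.1 + x.2, x.2) else (x.1, x.1 + t^-1 * x.2).

Definition act t W x := foldr (step t) x W.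

(** The vector (1, t^-1) is L applied to the vector (1, 1 - t) of infinity;
    it represents the number 1. *)
Definition word_vec t W := act t W (1, t^-1).

(** The coefficients are, up to a scalar, those of the adjugate of the symmetric
    matrix P, unique up to a scalar, with P R^T = R P and P L^T = L P. *)
Definition sform t x y : F :=
  (1 - t) * x.1 * y.1 - (x.1 * y.2 + x.2 * y.1) + (1 - t^-1) * x.2 * y.2.

Lemma sformC t x y : sform t x y = sform t y x.
Proof. by rewrite /sform; ring. Qed.

Lemma sform_step t b x y : t \is a GRing.unit ->
  sform t (step t b x) y = sform t x (step t b y).
Proof.
move=> tu; have tV : t * t^-1 = 1 by rewrite mulrV.
by case: b; rewrite /sform /step /=; ring: tV.
Qed.

(** An adjoint reverses the order of a product of self-adjoint operators. *)
Lemma sform_act t W x y : t \is a GRing.unit ->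
  sform t (act t W x) y = sform t x (act t (rev W) y).
Proof.
move=> tu; elim: W x y => //= b W IH x y.
by rewrite sform_step // IH rev_cons /act foldr_rcons.
Qed.

Lemma sform_infinity t y : t \is a GRing.unit ->
  sform t (1, 1 - t) y = (1 - t - t^-1) * y.2.
Proof. by move=> tu; have tV := mulrV tu; rewrite /sform /=; ring: tV. Qed.

Lemma word_vec_infinity t W : t \is a GRing.unit ->
  word_vec t W = act t (rcons W false) (1, 1 - t).
Proof.
move=> tu; rewrite /act foldr_rcons /word_vec /act /step /=.
by congr (foldr _ (_, _) _); rewrite mulrBr mulVr // mulr1 addrC subrK.
Qed.

(** The word of the matrix that acts on (1, 1 - t) is L W L, whose reversal is
    L (rev W) L.  The scalar is left in place because it need not be regular
    in an arbitrary ring. *)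
Lemma word_vec_rev t W : t \is a GRing.unit ->
  (1 - t - t^-1) * (word_vec t (false :: rev W)).2 =
  (1 - t - t^-1) * (word_vec t (false :: W)).2.
Proof.
move=> tu; rewrite -!sform_infinity // !word_vec_infinity //.
by rewrite sformC sform_act // !rcons_cons rev_cons rev_rcons revK.
Qed.

(** With J the coordinate swap, J R(t^-1) J = L(t) and J L(t^-1) J = R(t). *)
Lemma word_vec_flip t W : t \is a GRing.unit ->
  word_vec t^-1 W =
  (t * (word_vec t (map negb W)).2, t * (word_vec t (map negb W)).1).
Proof.
move=> tu; have tV := mulrV tu.
elim: W => [|b W]; first by rewrite /word_vec /= invrK mulr1 tV.
rewrite /word_vec /= => ->; rewrite /step /= invrK.
by case: b => /=; congr (_, _); ring: tV.
Qed.

(** If the word on the left belongs to x, the one on the right belongs to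
    1 - x: this is translation invariance across 0. *)
Lemma word_vec_flip_crossing t W : t \is a GRing.unit ->
  (word_vec t^-1 (false :: W)).2 = t ^+ 2 * (word_vec t (false :: map negb W)).2.
Proof.
move=> tu; have tV := mulrV tu.
rewrite {1}/word_vec [act _ _ _]/= -/(act t^-1 W _) -/(word_vec t^-1 W).
rewrite word_vec_flip // /word_vec /= /step /= invrK.
by ring: tV.
Qed.

(** At parameter 1 both generators have determinant 1. *)
Lemma area_act1 W x y :
  (act 1 W x).1 * (act 1 W y).2 - (act 1 W x).2 * (act 1 W y).1 =
  x.1 * y.2 - x.2 * y.1.
Proof.
elim: W => //= b W <-; rewrite /step; case: b => /=; last rewrite invr1; ring.
Qed.

(** At parameter 1 the adjoint of a matrix for [sform] exchanges its two
    diagonal entries; here the matrix of [W] is read off on (1, 0) and (0, 1). *)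
Lemma act1_infinity_rev W :
  (act 1 (rev W) (1, 0)).1 = (act 1 W (0, 1)).2.
Proof.
have := sform_act 1 W (0, 1) (1, 0) (unitr1 _).
by rewrite /sform /= invr1 !subrr !mul0r !addr0 !mulr0 !mul1r !mulr1 !sub0r !add0r
  => /oppr_inj ->.
Qed.

End WordAction.

(** * Positive rationals as words *)

Definition word_num W : int := (word_vec 1 W).1.
Definition word_den W : int := (word_vec 1 W).2.
Definition word_rat W : rat := (word_num W)%:Q / (word_den W)%:Q.

Lemma word_num_den_gt0 W : 0 < word_num W /\ 0 < word_den W.
Proof.
rewrite /word_num /word_den; elim: W => //= b W.
rewrite /word_vec /= /step; case: act => u w /= [u0 w0].
by case: b => /=; rewrite ?invr1 !mul1r; split=> //; apply: addr_gt0.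
Qed.

Lemma word_den_rev W :
  word_den (false :: rev W) = word_den (false :: W).
Proof.
have := word_vec_rev (1 : int) W isT.
by rewrite invr1 subrr sub0r !mulN1r => /oppr_inj.
Qed.

(** Bezout relation: in the matrix (r u; s v) of the word, v is the numerator
    of the reversed word. *)
Lemma word_num_rev W :
  exists u, word_num (false :: W) * word_num (false :: rev W) =
            1 + word_den (false :: W) * u.
Proof.
pose W2 := rcons (false :: W) false.
have W2r : rev W2 = rcons (false :: rev W) false.
  by rewrite rev_rcons rev_cons.
have E V : word_vec (1 : int) V = act 1 (rcons V false) (1, 0).
  by rewrite word_vec_infinity // subrr.
exists (act (1 : int) W2 (0, 1)).1.
rewrite /word_num /word_den !E -W2r act1_infinity_rev.
have := area_act1 W2 (1 : int, 0) (0, 1); rewrite /= mulr1 mulr0 subr0.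
by move/(canRL (subrK _)).
Qed.

Lemma word_rat_gt0 W : 0 < word_rat W.
Proof.
have [n0 d0] := word_num_den_gt0 W.
by rewrite divr_gt0 // ltr0z.
Qed.

Lemma word_rat_true W : word_rat (true :: W) = word_rat W + 1.
Proof.
have [_ d0] := word_num_den_gt0 W.
rewrite /word_rat /word_num /word_den {1 2}/word_vec /= -!/(word_vec _ _).
move: d0; rewrite /word_den; case: word_vec => u w /= w0.
by rewrite mul1r rmorphD mulrDl divff // intr_eq0 gt_eqF.
Qed.

Lemma word_rat_negb W : word_rat (map negb W) = (word_rat W)^-1.
Proof.
have := word_vec_flip (1 : int) W isT.
rewrite /word_rat /word_num /word_den invr1 !mul1r => ->.
by rewrite invf_div.
Qed.

Lemma word_rat_false W : (word_rat (false :: W))^-1 = (word_rat W)^-1 + 1.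
Proof. by rewrite -!word_rat_negb word_rat_true. Qed.

Lemma word_rat_false_lt1 W : word_rat (false :: W) < 1.
Proof.
rewrite -invf_gt1 ?word_rat_gt0 // word_rat_false ltrDr invr_gt0.
exact: word_rat_gt0.
Qed.

Lemma word_rat_true_gt1 W : 1 < word_rat (true :: W).
Proof. by rewrite word_rat_true ltrDr word_rat_gt0. Qed.

Lemma word_rat_nil : word_rat [::] = 1.
Proof. by rewrite /word_rat /word_num /word_den /= invr1 divff. Qed.

(** The first letter is determined by the position of the value relative
    to 1: words starting with R lie above it, words starting with L below. *)
Lemma word_rat_inj : injective word_rat.
Proof.
elim=> [|b W IH] [|c V] //.
- by case: c => E; [have := word_rat_true_gt1 V|have := word_rat_false_lt1 V];
    rewrite -E word_rat_nil ltxx.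
- by case: b => E; [have := word_rat_true_gt1 W|have := word_rat_false_lt1 W];
    rewrite E word_rat_nil ltxx.
case: b c => [] [] E.
- by congr (_ :: _); apply: IH; move: E; rewrite !word_rat_true => /addIr.
- have := word_rat_true_gt1 W; rewrite E => h.
  by have := lt_trans h (word_rat_false_lt1 V); rewrite ltxx.
- have := word_rat_true_gt1 V; rewrite -E => h.
  by have := lt_trans h (word_rat_false_lt1 W); rewrite ltxx.
congr (_ :: _); apply: IH; apply: invr_inj.
by apply: (addIr 1); rewrite -!word_rat_false E.
Qed.

(** Subtractive Euclidean algorithm; r and s need not be coprime. *)
Lemma word_rat_onto_frac (n r s : nat) : (r + s <= n)%N -> (0 < r)%N -> (0 < s)%N ->
  exists W, word_rat W = r%:R / s%:R.
Proof.
elim: n r s => [|n IH] r s; first by lia.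
move=> le_n r0 s0.
have rQ : r%:R != 0 :> rat by rewrite pnatr_eq0; lia.
have sQ : s%:R != 0 :> rat by rewrite pnatr_eq0; lia.
have [lt_rs|lt_sr|<-] := ltngtP r s; last by exists [::]; rewrite word_rat_nil divff.
  have [|||W WE] := IH r (s - r)%N; try lia.
  exists (false :: W); apply: invr_inj.
  rewrite word_rat_false WE !invf_div natrB 1?ltnW //.
  by rewrite mulrBl divff // subrK.
have [|||W WE] := IH (r - s)%N s; try lia.
exists (true :: W); rewrite word_rat_true WE natrB 1?ltnW //.
by rewrite mulrBl divff // subrK.
Qed.

Lemma word_rat_onto x : 0 < x -> exists W, x = word_rat W.
Proof.
move=> x0; have n0 : 0 < numq x by rewrite numq_gt0.
have d0 := denq_gt0 x.
have [||W WE] := @word_rat_onto_frac _ `|numq x|%N `|denq x|%N (leqnn _); try lia.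
by exists W; rewrite WE !natr_absz !gtr0_norm // divq_num_den.
Qed.

Lemma word_rat_onto_lt1 x : 0 < x -> x < 1 -> exists W, x = word_rat (false :: W).
Proof.
move=> x0; have [W ->] := word_rat_onto x x0.
case: W => [|[] W] lt1; last by exists W.
  by move: lt1; rewrite word_rat_nil ltxx.
by have := lt_trans lt1 (word_rat_true_gt1 W); rewrite ltxx.
Qed.

(** * The vectors of left q-rationals as word actions *)

Lemma q_unit : q \is a GRing.unit.
Proof. by rewrite unitfE q_neq0. Qed.

Definition side_par (neg : bool) : Kq := if neg then q^-1 else q.

(** For negative rationals, (u, w) |-> (u, - q w) conjugates the generators of
    parameter q^-1 into the inverses of Rq and Lq. *)
Definition side_vec (neg : bool) (z : Kq * Kq) : 'cV[Kq]_2 :=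
  if neg then cv2 z.1 (- q * z.2) else cv2 z.1 z.2.

Lemma act_nseq (F : comUnitRingType) (t : F) k b W x :
  act t (nseq k b ++ W) x = iter k (step t b) (act t W x).
Proof. by elim: k => //= k ->. Qed.

Lemma Rq_pow (neg : bool) (k : nat) z :
  Rq ^ ((-1) ^+ neg * k%:Z) *m side_vec neg z =
  side_vec neg (iter k (step (side_par neg) true) z).
Proof.
have q0 := q_neq0; case: neg; rewrite (expr0, expr1) ?mul1r ?mulN1r.
  rewrite -exprz_inv -exprnP.
  elim: k => [|k IH]; first by rewrite expr0 mul1mx.
  rewrite exprS -mulmxA IH RqV_act /side_vec /step /=.
  by rewrite mulNr opprK mulrDr mulKf.
rewrite -exprnP; elim: k => [|k IH]; first by rewrite expr0 mul1mx.
by rewrite exprS -mulmxA IH Rq_act.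
Qed.

Lemma Lq_pow (neg : bool) (k : nat) z :
  Lq ^ ((-1) ^+ neg * k%:Z) *m side_vec neg z =
  side_vec neg (iter k (step (side_par neg) false) z).
Proof.
have q0 := q_neq0; case: neg; rewrite (expr0, expr1) ?mul1r ?mulN1r.
  rewrite -exprz_inv -exprnP.
  elim: k => [|k IH]; first by rewrite expr0 mul1mx.
  rewrite exprS -mulmxA IH LqV_act /side_vec /step /= invrK.
  by rewrite !mulNr -opprD mulrN addrC.
rewrite -exprnP; elim: k => [|k IH]; first by rewrite expr0 mul1mx.
by rewrite exprS -mulmxA IH Lq_act.
Qed.

Lemma block_pow (neg : bool) (k1 k2 : nat) z :
  Rq ^ ((-1) ^+ neg * k1%:Z) *m (Lq ^ ((-1) ^+ neg * k2%:Z) *m side_vec neg z) =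
  side_vec neg (iter k1 (step (side_par neg) true)
                 (iter k2 (step (side_par neg) false) z)).
Proof. by rewrite -Rq_pow -Lq_pow. Qed.

(** The last letter of an even expansion is a power of Lq with nonzero exponent,
    and one factor of it turns infinity into 1 or -1, where words start. *)
Lemma Lq_infinity (neg : bool) :
  Lq ^ ((-1) ^+ neg) *m cv2 1 (1 - q) =
  side_vec neg (word_vec (side_par neg) [::]).
Proof.
have q0 := q_neq0; case: neg; rewrite /side_vec /side_par /=.
  by rewrite expr1 exprN1 LqV_act invrK addrAC subrr add0r mulrN mulNr.
by rewrite expr0 expr1z Lq_act mulrBr mulr1 mulVf // addrC subrK.
Qed.

Lemma word_rat_nseq_true k W : word_rat (nseq k true ++ W) = k%:R + word_rat W.
Proof.
elim: k => [|k IH]; first by rewrite add0r.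
by rewrite [_ ++ _]/= word_rat_true IH -addn1 natrD addrAC.
Qed.

Lemma word_rat_nseq_false k W :
  (word_rat (nseq k false ++ W))^-1 = k%:R + (word_rat W)^-1.
Proof.
elim: k => [|k IH]; first by rewrite add0r.
by rewrite [_ ++ _]/= word_rat_false IH -addn1 natrD addrAC.
Qed.

(** A continued fraction with exponents of constant sign is a run-length
    encoding of a word. *)
Lemma Mq_cf_word (neg : bool) (ns : seq nat) (a := [seq (-1) ^+ neg * k%:Z | k <- ns]) :
  ~~ odd (size ns) -> (0 < size ns)%N -> all (leq 1) (behead ns) ->
  exists W, cf_val a = (-1) ^+ neg * word_rat W /\
    Mq a *m cv2 1 (1 - q) = side_vec neg (word_vec (side_par neg) W).
Proof.
rewrite {}/a; have [m] := ubnP (size ns).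
have sgV (x : rat) : ((-1) ^+ neg * x)^-1 = (-1) ^+ neg * x^-1.
  by rewrite invfM -exprVn invrN1.
have sgD (k : nat) (x : rat) :
    ((-1) ^+ neg * k%:Z)%:~R + (-1) ^+ neg * x = (-1) ^+ neg * (k%:R + x).
  by rewrite rmorphM rmorphXn rmorphN1 mulrDr.
elim: m ns => // m IH [|k1 [|k2 ns]] //= sz ev _ /andP[k2_gt0 ns_gt0].
rewrite -!mulmxA.
have [ns0|ns_n0] := posnP (size ns).
  rewrite (size0nil ns0) /= mul1mx.
  (* One factor of the last block is used up by [Lq_infinity]. *)
  exists (nseq k1 true ++ nseq k2.-1 false); split.
    rewrite word_rat_nseq_true -sgD; congr (_ + _).
    rewrite -[nseq k2.-1 _]cats0 -[word_rat _]invrK word_rat_nseq_false.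
    rewrite word_rat_nil invr1 -sgV; congr _^-1.
    have := sgD k2 0; rewrite mulr0 invr0 => ->.
    by rewrite addr0 natr1 prednK.
  have -> : (-1) ^+ neg * k2%:Z = (-1) ^+ neg * k2.-1%:Z + (-1) ^+ neg.
    by rewrite -{1}(prednK k2_gt0) -addn1 PoszD mulrDr mulr1.
  rewrite exprzDr; last exact: Lq_unit.
  rewrite -mulmxA (Lq_infinity neg) block_pow.
  by rewrite /word_vec act_nseq -[nseq k2.-1 _]cats0 act_nseq.
have [||||W [vE mE]] := IH ns => //.
- by apply: leq_trans (ltnSE sz).
- by rewrite negbK in ev.
- by move: ns_gt0; case: (ns) => //= ? ? /andP[].
exists (nseq k1 true ++ nseq k2 false ++ W); split.
  rewrite vE sgV sgD sgV sgD word_rat_nseq_true; congr (_ * (_ + _)).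
  by rewrite -word_rat_nseq_false invrK.
by rewrite mE block_pow /word_vec !act_nseq.
Qed.

(** Only the value and the signs of the chosen expansion are known; injectivity
    of [word_rat] identifies the word that it encodes. *)
Lemma flat_vec_word (neg : bool) W :
  flat_vec ((-1) ^+ neg * word_rat W) =
  side_vec neg (word_vec (side_par neg) W).
Proof.
set x := _ * _; have W0 := word_rat_gt0 W.
suff [ns [nsE ev s0 ns_gt0]] : exists ns,
    [/\ even_cf x = [seq (-1) ^+ neg * k%:Z | k <- ns],
        ~~ odd (size ns), (0 < size ns)%N & all (leq 1) (behead ns)].
  have [V [vE mE]] := Mq_cf_word neg ns ev s0 ns_gt0.
  rewrite /flat_vec nsE mE; congr (side_vec _ (word_vec _ _)).
  apply: word_rat_inj; have /and3P[_ /eqP + _] := xchooseP (even_cf_ex x).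
  rewrite -/(even_cf x) nsE vE => /(congr1 ( *%R ((-1) ^+ neg))).
  by rewrite /x !mulrA -expr2 sqrr_sign !mul1r.
have /and3P[] := xchooseP (even_cf_ex x); rewrite -/(even_cf x).
move: (even_cf x) => a ev /eqP va.
have a0 : (0 < size a)%N.
  case: a va {ev} => //= va; have : x != 0.
    by rewrite mulf_neq0 ?signr_eq0 ?gt_eqF.
  by rewrite -va eqxx.
case: neg @x va => x; rewrite /x ?expr1 ?expr0 ?mul1r ?mulN1r => va.
  rewrite oppr_gt0 oppr_lt0 ltNge ltW // W0 /= => /andP[h t].
  exists (map absz a); rewrite size_map; split=> //.
    rewrite -map_comp map_id_in // => c c_a /=; rewrite mulN1r.
    case: a c_a h t {ev va a0} => //= d a; rewrite inE.
    by case/predU1P=> [->|ca] hd /allP t; [lia|have := t _ ca; lia].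
  case: a t {h ev va a0} => //= d a; rewrite all_map.
  by apply: sub_all => c /=; lia.
rewrite W0 => /andP[h t].
exists (map absz a); rewrite size_map; split=> //.
  rewrite -map_comp map_id_in // => c c_a /=; rewrite mul1r.
  case: a c_a h t {ev va a0} => //= d a; rewrite inE.
  by case/predU1P=> [->|ca] hd /allP t; [lia|have := t _ ca; lia].
case: a t {h ev va a0} => //= d a; rewrite all_map.
by apply: sub_all => c /=; lia.
Qed.

Lemma flat_vec0 : flat_vec 0 1 0 = q^-1.
Proof.
have /and3P[_ _] := xchooseP (even_cf_ex 0); rewrite -/(even_cf 0).
move=> /eqP E; rewrite /flat_vec E /= mulmx1 -mulmxA expr1z Lq_act exprN1 RqV_act.
by rewrite !mxE /= mulrBr mulr1 mulVf ?q_neq0 // addrC subrK.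
Qed.

(** * Equivalence up to sign and powers of q *)

Lemma qequiv_scale (b : bool) (n : int) f : qequiv ((-1) ^+ b * q ^ n * f) f.
Proof. by exists b, n. Qed.

Lemma qequiv_refl f : qequiv f f.
Proof. by exists false, 0; rewrite expr0 expr0z !mul1r. Qed.

Lemma qequiv_trans f g h : qequiv f g -> qequiv g h -> qequiv f h.
Proof.
move=> [b [n ->]] [c [m ->]]; exists (b (+) c), (n + m).
by rewrite signr_addb q_expD mulrA; congr (_ * h); apply: mulrACA.
Qed.

Lemma qequiv_sym f g : qequiv f g -> qequiv g f.
Proof.
move=> [b [n ->]]; exists b, (- n).
by rewrite mulrA mulrACA -expr2 sqrr_sign -q_expD addNr expr0z !mul1r.
Qed.

Lemma qequiv_tofrac_sign (p r : {poly int}) : p.[0] != 0 -> r.[0] != 0 ->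
  qequiv (tofrac p) (tofrac r) -> exists b : bool, p = (-1) ^+ b * r.
Proof.
move=> p0 r0 [b [n E]]; exists b.
wlog n0 : n p r p0 r0 E / 0 <= n.
  case: (leP 0 n) => [h H|/ltW h H]; first exact: (H n).
  have : r = (-1) ^+ b * p.
    apply: (H (- n) r p) => //; last by rewrite oppr_ge0.
    by rewrite E mulrA mulrACA -expr2 sqrr_sign -q_expD addNr expr0z !mul1r.
  by move->; rewrite mulrA -expr2 sqrr_sign mul1r.
have {E} : p = (-1) ^+ b * 'X^`|n|%N * r.
  apply/eqP; rewrite -tofrac_eq !tofracM !tofracXn tofracN tofrac1 -/q E.
  by rewrite -[in q ^ n](gez0_abs n0).
case: `|n|%N => [->|k Ep]; first by rewrite expr0 mulr1.
by move: p0; rewrite Ep !hornerE /= exprS mul0r mulr0 mul0r eqxx.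
Qed.

(** * Translation invariance of the denominator *)

Lemma flat_vec_Sflat x :
  qequiv (flat_vec x 1 0) (tofrac (Sflat x)) /\ (Sflat x).[0] = 1.
Proof.
have := xchooseP (flat_normalization_ex x); rewrite -/(flat_normalization x).
rewrite /Sflat; case: (flat_normalization x) => [[b n] s] /= /andP[/eqP E /eqP s0].
by split=> //; apply: qequiv_sym; rewrite -E; apply: qequiv_scale.
Qed.

Lemma Rflat_flat_vec x : qequiv (Rflat x) (flat_vec x 0 0).
Proof.
rewrite /Rflat; case: (flat_normalization x) => [[b n] s].
exact: qequiv_scale.
Qed.

Lemma sign_eq1 (b : bool) : (-1) ^+ b = 1 :> int -> b = false.
Proof. by case: b. Qed.

Lemma Sflat_eq x p : p.[0] = 1 -> qequiv (flat_vec x 1 0) (tofrac p) ->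
  Sflat x = p.
Proof.
move=> p0 E; have [E' s0] := flat_vec_Sflat x.
have [|||b Sb] := @qequiv_tofrac_sign (Sflat x) p; rewrite ?s0 ?p0 //.
  exact: qequiv_trans (qequiv_sym _ _ E') E.
move: (s0); rewrite Sb -polyC1 -polyCN -polyC_exp !hornerE p0 mulr1.
by move/sign_eq1 ->; rewrite expr0 polyC1 mul1r.
Qed.

Lemma Sflat_congr x y : qequiv (flat_vec x 1 0) (flat_vec y 1 0) ->
  Sflat x = Sflat y.
Proof.
move=> E; have [E' s0] := flat_vec_Sflat y.
by apply: Sflat_eq => //; apply: qequiv_trans E E'.
Qed.

Lemma flat_vec_pos W :
  flat_vec (word_rat W) = cv2 (word_vec q W).1 (word_vec q W).2.
Proof. by have := flat_vec_word false W; rewrite mul1r. Qed.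

Lemma flat_vec_neg W : flat_vec (- word_rat W) =
  cv2 (word_vec q^-1 W).1 (- q * (word_vec q^-1 W).2).
Proof. by have := flat_vec_word true W; rewrite mulN1r. Qed.

Lemma flat_den_pos W :
  qequiv (flat_vec (word_rat W) 1 0) (word_vec q W).2.
Proof. by rewrite flat_vec_pos mxE; apply: qequiv_refl. Qed.

Lemma flat_den_neg W :
  qequiv (flat_vec (- word_rat W) 1 0) (word_vec q^-1 W).2.
Proof. by rewrite flat_vec_neg mxE; exists true, 1; rewrite expr1z mulN1r. Qed.

Lemma rat_word_ind (P : rat -> Prop) : P 0 ->
  (forall W, P (word_rat W)) -> (forall W, P (- word_rat W)) -> forall x, P x.
Proof.
move=> P0 Ppos Pneg x; case: (ltgtP x 0) => [x0|x0|->] //.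
  have [|W E] := @word_rat_onto (- x); first by rewrite oppr_gt0.
  by rewrite -[x]opprK E.
by have [W ->] := word_rat_onto _ x0.
Qed.

(** Translation adds a leading R to the word of x > 0 and removes one from the
    word of -x if x < -1.  If x = -y with 0 < y < 1, then x + 1 = 1 - y and
    [word_vec_flip_crossing] applies; x = 0 and x = -1 are computed. *)
Lemma Sflat_add1 x : Sflat (x + 1) = Sflat x.
Proof.
elim/rat_word_ind: x => [|W|W]; apply: Sflat_congr.
- rewrite add0r -word_rat_nil; apply: qequiv_trans (flat_den_pos _) _.
  by rewrite flat_vec0; apply: qequiv_refl.
- rewrite -word_rat_true; apply: qequiv_trans (flat_den_pos _) _.
  by apply: qequiv_sym; apply: flat_den_pos.
apply: qequiv_sym; apply: qequiv_trans (flat_den_neg _) _; apply: qequiv_sym.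
case: W => [|[] W].
- rewrite word_rat_nil addNr flat_vec0 /= invrK.
  by exists false, (-2); rewrite mul1r -[X in _ * X]expr1z -q_expD exprN1.
- rewrite word_rat_true opprD subrK; apply: qequiv_trans (flat_den_neg _) _.
  exact: qequiv_refl.
have -> : - word_rat (false :: W) + 1 = word_rat (false :: map negb W).
  apply: invr_inj; rewrite word_rat_false word_rat_negb invrK.
  have w0 := word_rat_gt0 W; have := word_rat_false W.
  move/(canRL (@invrK _)) => ->; field; lra.
apply: qequiv_trans (flat_den_pos _) _; rewrite word_vec_flip_crossing ?q_unit //.
by apply: qequiv_sym; exists false, 2; rewrite mul1r -exprnP.
Qed.

Lemma Sflat_addz x (k : int) : Sflat (x + k%:~R) = Sflat x.
Proof.
have addn y n : Sflat (y + n%:R) = Sflat y.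
  elim: n => [|n IH]; first by rewrite addr0.
  by rewrite -natr1 addrA Sflat_add1.
case: k => n; first exact: addn.
by rewrite NegzE mulrNz -(addn _ n.+1) subrK.
Qed.

Lemma Sflat_mod (r r' s : int) : 0 < s -> (r = r' %[mod s])%Z ->
  Sflat (r%:Q / s%:Q) = Sflat (r'%:Q / s%:Q).
Proof.
move=> s0 /eqP; rewrite eqz_mod_dvd => /dvdzP[k E].
have sQ : s%:Q != 0 by rewrite intr_eq0 gt_eqF.
rewrite -(Sflat_addz (r'%:Q / s%:Q) k); congr Sflat.
have -> : r = k * s + r' by rewrite -E subrK.
by rewrite rmorphD rmorphM mulrDl mulfK // addrC.
Qed.

(** Translation-invariant statements need only be checked on positive
    rationals. *)
Lemma rat_shift_ind (P : rat -> Prop) :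
  (forall x (k : int), P (x + k%:~R) -> P x) -> (forall W, P (word_rat W)) ->
  forall x, P x.
Proof.
move=> Pshift Ppos x; apply: (Pshift x (1 - Num.floor x)).
have [|W ->] := @word_rat_onto (x + (1 - Num.floor x)%:~R) => //.
have := floor_le x.
rewrite rmorphB /=; lra.
Qed.

(** * Inversion of q and reciprocals *)

Lemma poly_at_qVD p r : poly_at_qV (p + r) = poly_at_qV p + poly_at_qV r.
Proof. by rewrite /poly_at_qV rmorphD hornerD. Qed.

Lemma poly_at_qVX : poly_at_qV 'X = q^-1.
Proof. by rewrite /poly_at_qV map_polyX hornerX. Qed.

Lemma poly_at_qV1 : poly_at_qV 1 = 1.
Proof. by rewrite /poly_at_qV rmorph1 hornerC. Qed.

(** The two actions of a word, with parameters q and q^-1, are exchanged by the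
    substitution of q^-1 for q.  The values at 0 and 1 are carried along
    because they fix the normalization and the sign of the denominator; the
    one at 1 of the numerator is needed for the induction. *)
Lemma word_vec_laurent W : exists (n : int) (p r : {poly int}),
  [/\ word_vec q W = (q ^ n * tofrac p, q ^ n * tofrac r),
      word_vec q^-1 W = (q ^ (- n) * poly_at_qV p, q ^ (- n) * poly_at_qV r),
      r.[0] = 1, 0 < p.[1] & 0 < r.[1]].
Proof.
have q0 := q_neq0.
elim: W => [|b W [n [p [r [E EV r0 p1 r1]]]]].
  exists (-1), 'X, 1; split; rewrite ?hornerC ?hornerX //.
    by rewrite /word_vec /= exprN1 tofrac1 mulr1 -/q mulVf.
  by rewrite /word_vec /= poly_at_qV1 poly_at_qVX opprK expr1z mulr1 mulfV // invrK.
rewrite !/word_vec /= -!/(word_vec _ _) E EV; case: b; rewrite /step /=.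
  exists n, ('X * p + r), r; split=> //; last by rewrite !hornerE addr_gt0.
    by rewrite tofracD tofracM -/q mulrDr [q * _]mulrCA.
  by rewrite poly_at_qVD poly_at_qVM poly_at_qVX mulrDr [q^-1 * _]mulrCA.
exists (n - 1), ('X * p), ('X * p + r); split.
- rewrite tofracD tofracM -/q mulrDr q_expD exprN1.
  by rewrite [_ / q * (q * _)]mulrA mulfVK // mulrCA mulrA.
- rewrite poly_at_qVD poly_at_qVM poly_at_qVX mulrDr opprB q_expD expr1z.
  rewrite invrK [q * _ * (q^-1 * _)]mulrACA mulfV // mul1r.
  by rewrite -[q * _ * poly_at_qV r]mulrA.
- by rewrite !hornerE.
- by rewrite !hornerE.
- by rewrite !hornerE addr_gt0.
Qed.

Lemma horner1_Poly (s : seq int) : (Poly s).[1] = \sum_(c <- s) c.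
Proof.
rewrite horner_Poly; elim: s => [|c s IH] /=; first by rewrite big_nil.
by rewrite big_cons IH mulr1 addrC.
Qed.

Lemma horner1_rev (p : {poly int}) : (Poly (rev p)).[1] = p.[1].
Proof.
rewrite horner1_Poly -{2}(polyseqK p) horner1_Poly.
by apply: perm_big; rewrite perm_rev.
Qed.

Lemma horner0_rev (p : {poly int}) : (Poly (rev p)).[0] = lead_coef p.
Proof.
have [->|p0] := eqVneq p 0; first by rewrite polyseq0 horner0 lead_coef0.
by rewrite horner_coef0 coef_Poly nth_rev ?size_poly_gt0 // subn1.
Qed.

Lemma recip_at_qV (n : int) p : p != 0 ->
  qequiv (recip (q ^ n * tofrac p)) (poly_at_qV p).
Proof.
move=> p0; rewrite recip_laurent // -poly_at_qV_rev.
by exists false, (size p).-1; rewrite expr0 mul1r mulrC -exprnP.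
Qed.

Lemma recip_tofrac p : p != 0 -> recip (tofrac p) = tofrac (Poly (rev p)).
Proof. by move=> p0; have := recip_laurent 0 p0; rewrite expr0z mul1r. Qed.

Lemma recip_tofrac_at_qV p : p != 0 -> qequiv (recip (tofrac p)) (poly_at_qV p).
Proof. by move=> p0; have := recip_at_qV 0 p p0; rewrite expr0z mul1r. Qed.

(** The shift by a power of q is absorbed by the degree in the definition of
    the reciprocal, the sign is not. *)
Lemma recip_qequiv f p : p != 0 -> qequiv f (tofrac p) ->
  qequiv (recip f) (recip (tofrac p)).
Proof.
move=> p0 [b [n ->]].
have -> : (-1) ^+ b * q ^ n * tofrac p = q ^ n * tofrac ((-1) ^+ b * p).
  by rewrite tofracM tofracXn tofracN tofrac1 [_ * q ^ n]mulrC mulrA.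
apply: qequiv_trans (recip_at_qV _ _ _) _; first by rewrite mulf_neq0 ?signr_eq0.
apply: qequiv_trans (_ : qequiv _ (poly_at_qV p)) _.
  exists b, 0; rewrite poly_at_qVM expr0z mulr1; congr (_ * _).
  by rewrite /poly_at_qV rmorphXn rmorphN1 -polyC1 -polyCN -polyC_exp hornerC.
by apply: qequiv_sym; apply: recip_tofrac_at_qV.
Qed.

Lemma Sflat_word n p W : p.[0] = 1 -> (word_vec q W).2 = q ^ n * tofrac p ->
  Sflat (word_rat W) = p.
Proof.
move=> p0 E; apply: Sflat_eq => //; apply: qequiv_trans (flat_den_pos W) _.
by rewrite E; exists false, n; rewrite expr0 mul1r.
Qed.

Lemma Sflat_gt0 x : 0 < (Sflat x).[1].
Proof.
elim/rat_shift_ind: x => [x k|W]; first by rewrite Sflat_addz.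
have [n [p [r [E _ r0 _ r1]]]] := word_vec_laurent W.
by rewrite (Sflat_word n r W) // E.
Qed.

Lemma Sflat_neq0 x : Sflat x != 0.
Proof. by apply/eqP => E; have := Sflat_gt0 x; rewrite E horner0 ltxx. Qed.

(** Both sides are equivalent to the lower entry of the word of x > 0 with q^-1
    in place of q.  Having nonzero constant terms, they agree up to sign, and
    both are positive at q = 1. *)
Lemma Sflat_opp x : tofrac (Sflat (- x)) = recip (tofrac (Sflat x)).
Proof.
elim/rat_shift_ind: x => [x k|W].
  by rewrite opprD -mulrNz !Sflat_addz.
have [n [p [r [E EV r0 _ r1]]]] := word_vec_laurent W.
have SW : Sflat (word_rat W) = r by rewrite (Sflat_word n r W) // E.
have rn0 : r != 0 by rewrite -SW Sflat_neq0.
rewrite SW recip_tofrac //; congr tofrac.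
have [S_eq S0] := flat_vec_Sflat (- word_rat W).
have [|||b Eb] := @qequiv_tofrac_sign (Sflat (- word_rat W)) (Poly (rev r)).
- by rewrite S0.
- by rewrite horner0_rev lead_coef_eq0.
- apply: qequiv_trans (qequiv_sym _ _ S_eq) _.
  apply: qequiv_trans (flat_den_neg W) _; rewrite EV /= -recip_tofrac //.
  apply: qequiv_trans (_ : qequiv _ (poly_at_qV r)) _.
    by exists false, (- n); rewrite expr0 mul1r.
  by apply: qequiv_sym; apply: recip_tofrac_at_qV.
move: (Sflat_gt0 (- word_rat W)); rewrite Eb.
case: b {Eb}; last by rewrite expr0 mul1r.
by rewrite expr1 mulN1r hornerN horner1_rev oppr_gt0 ltNge ltW.
Qed.

(** Exchanging the letters of the word of x moves the upper entry down and
    inverts both q and x; inverting q back amounts to a change of sign of x. *)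
Lemma Rflat_Sflat x : x != 0 -> qequiv (Rflat x) (tofrac (Sflat (- x^-1))).
Proof.
move=> x0; apply: qequiv_trans (Rflat_flat_vec x) _.
apply: qequiv_trans (_ : qequiv _ (flat_vec (- x^-1) 1 0)) _; last first.
  by have [] := flat_vec_Sflat (- x^-1).
elim/rat_word_ind: x x0 => [|W _|W _]; first by rewrite eqxx.
  rewrite -word_rat_negb flat_vec_pos mxE /=.
  apply: qequiv_sym; apply: qequiv_trans (flat_den_neg _) _.
  rewrite (word_vec_flip _ _ q_unit) -map_comp (eq_map negbK) map_id.
  by exists false, 1; rewrite expr0 mul1r expr1z.
rewrite invrN opprK -word_rat_negb flat_vec_neg mxE /=.
apply: qequiv_sym; apply: qequiv_trans (flat_den_pos _) _.
apply: qequiv_sym; rewrite (word_vec_flip _ _ q_unit).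
by exists false, 1; rewrite expr0 mul1r expr1z.
Qed.

(** * Reversal and inverses modulo the denominator *)

Lemma sform_factor_neq0 : 1 - q - q^-1 != 0.
Proof.
have q0 := q_neq0.
suff h : q * (1 - q - q^-1) != 0 by apply: contraNneq h => ->; rewrite mulr0.
have -> : q * (1 - q - q^-1) = tofrac ('X - 'X * 'X - 1).
  by rewrite !tofracB tofracM tofrac1 -/q !mulrBr mulr1 mulfV.
rewrite tofrac_eq0; apply/eqP => /(congr1 (horner^~ 0)); rewrite !hornerE /=.
by [].
Qed.

Lemma Sflat_word_rev W :
  Sflat (word_rat (false :: rev W)) = Sflat (word_rat (false :: W)).
Proof.
apply: Sflat_congr; rewrite !flat_vec_pos !mxE.
rewrite [(_ == 0)]/=; have := word_vec_rev q W q_unit.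
by move/(mulfI sform_factor_neq0) => ->; apply: qequiv_refl.
Qed.

(** By [word_num_rev] the fraction of the word is irreducible, and irreducible
    fractions with positive denominators are determined by their value. *)
Lemma word_frac_irreducible W (r s : int) : 0 < s -> coprimez r s ->
  r%:Q / s%:Q = word_rat (false :: W) ->
  r = word_num (false :: W) /\ s = word_den (false :: W).
Proof.
move=> s0 rs; have [n0 d0] := word_num_den_gt0 (false :: W).
have [u bez] := word_num_rev W.
rewrite /word_rat => /eqP; rewrite eqr_div ?intr_eq0 ?lt0r_neq0 //.
rewrite -!intrM => /eqP /intr_inj E.
have cop : coprimez (word_num (false :: W)) (word_den (false :: W)).
  apply/coprimezP; exists (word_num (false :: rev W), - u) => /=.
  by rewrite mulrC bez; ring.
have sd : (s %| word_den (false :: W))%Z.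
  rewrite -(@Gauss_dvdzr _ r); last by rewrite coprimez_sym.
  by rewrite E dvdz_mull.
have ds : (word_den (false :: W) %| s)%Z.
  rewrite -(@Gauss_dvdzr _ (word_num (false :: W))); last by rewrite coprimez_sym.
  by rewrite -E dvdz_mull.
have Es : s = word_den (false :: W).
  apply/eqP; rewrite -[s]gtz0_abs // -[X in _ == X]gtz0_abs // eqz_nat eqn_dvd.
  by rewrite -!dvdzE sd ds.
split=> //; move: E; rewrite -Es; apply: mulIf; exact: lt0r_neq0.
Qed.

(** After reduction to 0 < r < s the word of r/s starts with L, so that it can
    be reversed; the reversed word has the value v/s with rv = 1 modulo s,
    hence v = r' modulo s. *)
Lemma Sflat_inverse (r r' s : int) : 0 < s -> coprimez r s ->
  (r * r' = 1 %[mod s])%Z -> Sflat (r%:Q / s%:Q) = Sflat (r'%:Q / s%:Q).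
Proof.
move=> s0 rs rr'; have [s1|s_neq1] := eqVneq s 1.
  by apply: Sflat_mod => //; rewrite s1 !modz1.
have sn0 : s != 0 by rewrite gt_eqF.
rewrite (Sflat_mod r (r %% s)%Z s s0 (esym (modz_mod _ _))).
have rs1 : coprimez (r %% s)%Z s by rewrite /coprimez gcdz_modl.
have r1_ge0 := modz_ge0 r sn0; have r1_lt := ltz_pmod r s0.
have r1_gt0 : 0 < (r %% s)%Z.
  rewrite lt_def r1_ge0 andbT; apply/eqP => z.
  by move: rs1; rewrite z /coprimez gcd0z => /eqP; lia.
have rr1 : ((r %% s)%Z * r' = 1 %[mod s])%Z by rewrite modzMml.
move: (r %% s)%Z rs1 r1_lt r1_gt0 rr1 => {rs rr' r1_ge0}r rs r_lt r0 rr'.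
have sQ0 : 0 < s%:Q by rewrite ltr0z.
have x0 : 0 < r%:Q / s%:Q by rewrite divr_gt0 ?ltr0z.
have x1 : r%:Q / s%:Q < 1 by rewrite ltr_pdivrMr // mul1r ltr_int.
have [W EW] := word_rat_onto_lt1 _ x0 x1.
have [Er Es] := word_frac_irreducible W r s s0 rs EW.
rewrite EW -Sflat_word_rev /word_rat word_den_rev -Es.
apply: Sflat_mod => //; apply/eqP; rewrite eqz_mod_dvd.
rewrite -(@Gauss_dvdzr _ r); last by rewrite coprimez_sym.
have [u bez] := word_num_rev W; rewrite -Er -Es in bez.
rewrite mulrBr -eqz_mod_dvd rr' bez; apply/eqP.
by rewrite -modzDmr modzMr addr0.
Qed.

Lemma Sflat_inverse_opp (r r' s : int) : 0 < s -> coprimez r s ->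
  (r * r' = -1 %[mod s])%Z ->
  tofrac (Sflat (r%:Q / s%:Q)) = recip (tofrac (Sflat (r'%:Q / s%:Q))).
Proof.
move=> s0 rs rr'.
have nE : - (r'%:Q / s%:Q) = (- r')%:Q / s%:Q by rewrite rmorphN mulNr.
rewrite -(Sflat_opp (r'%:Q / s%:Q)) nE (Sflat_inverse r (- r') s s0 rs) //.
apply/eqP.
have /eqP := rr'; rewrite !eqz_mod_dvd opprK.
by rewrite mulrN -opprD rpredN.
Qed.

Lemma Rflat_frac (r s : int) : r != 0 -> 0 < s ->
  qequiv (Rflat (r%:Q / s%:Q))
         (tofrac (Sflat ((- sgz r * s)%:Q / `|r|%:Q))).
Proof.
move=> r0 s0; have x0 : r%:Q / s%:Q != 0.
  by rewrite mulf_neq0 ?invr_eq0 ?intr_eq0 // gt_eqF.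
have -> : (- sgz r * s)%:Q / `|r|%:Q = - (r%:Q / s%:Q)^-1.
  rewrite invf_div; case: (ltgtP r 0) r0 => [r0|r0|->] // _.
    by rewrite ltr0_sgz // ltr0_norm // opprK mul1r rmorphN invrN mulrN.
  by rewrite gtr0_sgz // gtr0_norm // mulN1r rmorphN mulNr.
exact: Rflat_Sflat.
Qed.

Theorem theorem4p7 :
  (forall r r' s : int, 0 < s -> coprimez r s -> coprimez r' s ->
     ((r * r' = 1 %[mod s])%Z ->
        Sflat (r%:Q / s%:Q) = Sflat (r'%:Q / s%:Q)) /\
     ((r * r' = -1 %[mod s])%Z ->
        tofrac (Sflat (r%:Q / s%:Q)) = recip (tofrac (Sflat (r'%:Q / s%:Q)))))
  /\
  (forall r s s' : int, 0 < s -> 0 < s' -> coprimez r s -> coprimez r s' ->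
     ((s * s' = 1 %[mod r])%Z ->
        qequiv (Rflat (r%:Q / s%:Q)) (Rflat (r%:Q / s'%:Q))) /\
     ((s * s' = -1 %[mod r])%Z ->
        qequiv (Rflat (r%:Q / s%:Q)) (recip (Rflat (r%:Q / s'%:Q))))).
Proof.
split=> [r r' s s0 rs _|r s s' s0 s'0 rs rs'].
  by split; [apply: Sflat_inverse|apply: Sflat_inverse_opp].
(* For r = 0 both denominators are 1, and 1 = -1 fails modulo 0. *)
have [r0|r0] := eqVneq r 0.
  move: rs rs'; rewrite r0 /coprimez !gcd0z => /eqP s1 /eqP s'1.
  have -> : s = 1 by lia.
  have -> : s' = 1 by lia.
  by split=> [_|]; [apply: qequiv_refl|rewrite !modz0].
have norm_r0 : 0 < `|r| by rewrite normr_gt0.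
have cop : coprimez (- sgz r * s) `|r|.
  rewrite coprimez_sym; move: rs r0; rewrite /coprimez; clear.
  case: (ltgtP r 0) => [r0|r0|->] // rs _.
    by rewrite ltr0_sgz // ltr0_norm // opprK mul1r gcdNz.
  by rewrite gtr0_sgz // gtr0_norm // mulN1r gcdzN.
have prod : (- sgz r * s) * (- sgz r * s') = s * s'.
  by rewrite mulrACA mulrNN mulz_sg r0 mul1r.
have RS := Rflat_frac r s r0 s0.
have RS' := Rflat_frac r s' r0 s'0.
split=> ss'; apply: qequiv_trans RS _.
  rewrite (@Sflat_inverse _ (- sgz r * s') _ norm_r0 cop); last first.
    by rewrite prod -abszE !modz_abs.
  exact: qequiv_sym RS'.
rewrite (@Sflat_inverse_opp _ (- sgz r * s') _ norm_r0 cop); last first.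
  by rewrite prod -abszE !modz_abs.
by apply: qequiv_sym; apply: recip_qequiv RS'; apply: Sflat_neq0.
Qed.
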